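(* Suppose that $\beta=0$. Let $\mathcal{I}$ be an ideal of $\mathcal{K}_j$. (a) If $\mathcal{I}=\{0\}$, then $|\mathcal{I}|=1$. (b) If $\mathcal{I}=\mathcal{K}_j$, then $|\mathcal{I}|=p^{2md_jp^s}$. (c) If $\mathcal{I}=\langle\gamma f_j(x)^\tau\rangle$ is of Type II, then $|\mathcal{I}|=p^{md_j(p^s-\tau)}$. (d) Let $\mathcal{I}=\langle f_j(x)^\omega+\gamma f_j(x)^tG(x)\rangle$ be of Type III. When $\operatorname{char}\mathcal{R}_2=p$, we have $$|\mathcal{I}|=\begin{cases} p^{2md_j(p^s-\omega)}&\text{if either }G(x)=0\text{ or }G(x)\neq0\text{ and }p^s-2\omega+t\ge0; \\ p^{md_j(p^s-t)}&\text{if }G(x)\neq0\text{ and }p^s-2\omega+t<0.\end{cases}$$ When $\operatorname{char}\mathcal{R}_2=p^2$, write $\gamma(M_j(x)-G(x))=\gamma f_j(x)^\delta A_G(x)$ in $\mathcal{K}_j$, where $0\le\delta<p^s$ and $A_G(x)$ is either $0$ or a unit in $\mathcal{K}_j$. Then: (1) $|\mathcal{I}|=p^{2md_j(p^s-\omega)}$ if one of the following holds: $G(x)=0$ and $\omega\le p^{s-1}$; or $G(x)\neq0$, $p^s-2\omega+t\ge0$, $\omega\le p^{s-1}$ and $\omega\neq p^s-p^{s-1}+t$; or $A_G(x)=0$ and $\omega=p^s-p^{s-1}+t$; or $A_G(x)\neq0$, $\omega=p^s-p^{s-1}+t$ and $\delta\ge p^s-p^{s-1}$; or $A_G(x)\neq0$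 and $\omega=p^s-p^{s-1}+t\le p^{s-1}+\delta$; (2) $|\mathcal{I}|=p^{md_j(p^s-t)}$ if $G(x)\neq0$, $p^s-2\omega+t\le0$ and $p^s-p^{s-1}-\omega+t<0$; (3) $|\mathcal{I}|=p^{md_j(2p^s-\omega-p^{s-1})}$ if $G(x)=0$ and $\omega>p^{s-1}$, or $G(x)\neq0$, $\omega\ge p^{s-1}$ and $p^s-p^{s-1}-\omega+t>0$; (4) $|\mathcal{I}|=p^{md_j(2p^s-\omega-p^{s-1}-\delta)}$ if $A_G(x)\neq0$, $\omega=p^s-p^{s-1}+t$ and $\omega>p^{s-1}+\delta$. (e) If $\mathcal{I}=\langle f_j(x)^\omega+\gamma f_j(x)^tG(x),\gamma f_j(x)^\mu\rangle$ is of Type IV, then $|\mathcal{I}|=p^{md_j(2p^s-\mu-\omega)}$.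
   Context: $\mathcal{R}_2$ is a finite commutative chain ring with unity, with maximal ideal $\langle\gamma\rangle$, where $\gamma\neq0$ and $\gamma^2=0$; its residue field has order $p^m$, $p$ prime; $\operatorname{char}\mathcal{R}_2\in\{p,p^2\}$. $\zeta\in\mathcal{R}_2$ has multiplicative order $p^m-1$ and $\mathcal{T}_2=\{0,1,\zeta,\dots,\zeta^{p^m-2}\}$. $n,s$ are positive integers with $\gcd(n,p)=1$. $\alpha\in\mathcal{T}_2\setminus\{0\}$, $\beta\in\mathcal{T}_2$, $\lambda=\alpha+\gamma\beta$, and $\alpha_0\in\mathcal{T}_2$ satisfies $\alpha_0^{p^s}=\alpha$. Write $x^n-\alpha_0=f_1(x)\cdots f_r(x)$ with $f_j$ monic, pairwise coprime and basic irreducible (irreducible modulo $\gamma$) in $\mathcal{R}_2[x]$, $d_j=\deg f_j$. Then $x^{np^s}-\lambda=\prod_{j=1}^rk_j(x)$ with $k_j=f_j^{p^s}+\gamma g_j$ monic, pairwise coprime, of degree $d_jp^s$ (uniquely determined). When $\beta=0$: if $\operatorname{char}\mathcal{R}_2=p$ then $k_j=f_j^{p^s}$; if $\operatorname{char}\mathcal{R}_2=p^2$ one can take $g_j=f_j^{p^{s-1}}M_j$ with $M_j\in\mathcal{R}_2[x]$ coprime to $f_j$; fix such $M_j$. Fix $1\le j\le r$ and put $\mathcal{K}_j=\mathcal{R}_2[x]/\langle k_j(x)\rangle$. $\mathcal{P}_{d_j}(\mathcal{T}_2)$ denotes the set of polynomials with coefficients in $\mathcal{T}_2$ that are $0$ or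 of degree less than $d_j$. For $\beta=0$ the ideals of $\mathcal{K}_j$ are: Type I: $\{0\}$, $\mathcal{K}_j$. Type II: $\langle\gamma f_j^\tau\rangle$, $0\le\tau<p^s$. Type III: $\langle f_j^\omega+\gamma f_j^tG\rangle$, where $0<\omega<p^s$, $0\le t<\kappa$ if $G\neq0$, and $G$ is $0$ or a unit of $\mathcal{K}_j$ of the form $\sum_{i=0}^{\kappa-t-1}a_i(x)f_j(x)^i$ with $a_i\in\mathcal{P}_{d_j}(\mathcal{T}_2)$. Type IV: $\langle f_j^\omega+\gamma f_j^tG,\gamma f_j^\mu\rangle$, where $0\le\mu<\kappa\le\omega<p^s$, $0\le t<\mu$ if $G\neq0$, and $G$ is $0$ or a unit of $\mathcal{K}_j$ of the form $\sum_{i=0}^{\mu-t-1}a_i(x)f_j(x)^i$ with $a_i\in\mathcal{P}_{d_j}(\mathcal{T}_2)$. In both types $\kappa$ is the smallest non-negative integer with $\gamma f_j^\kappa\in\langle f_j^\omega+\gamma f_j^tG\rangle$ (so $\kappa\le\omega$). *)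

(* Defs.v *)
From HB Require Import structures.
From mathcomp Require Import all_boot all_order all_algebra.

Set Implicit Arguments.
Unset Strict Implicit.
Unset Printing Implicit Defensive.

Import GRing.Theory.
Local Open Scope ring_scope.

(* Lets {poly %/ h} be inferred as a finComNzRingType.  Pitfall: {poly %/ h} is
   the quotient by h only when h is monic and non-constant. *)
HB.instance Definition _ (R : finComNzRingType) (h : {poly R}) :=
  Finite.copy {poly %/ h} (qpoly h).

(* The library's idealr_closed and its structures only cover proper ideals, so
   an ideal is taken to be a submodule of the regular module. *)
Definition is_ideal (A : finComNzRingType) (I : {set A}) : Prop :=
  GRing.submod_closed (I : {pred A^o}).

Definition pideal (A : finComNzRingType) (a : A) : {set A} :=
  [set c * a | c : A].

Definition pideal2 (A : finComNzRingType) (a b : A) : {set A} :=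
  [set c * a + e * b | c : A, e : A].

Definition maximal_ideal (A : finComNzRingType) (I : {set A}) : Prop :=
  [/\ is_ideal I, I != setT &
      forall J : {set A}, is_ideal J -> I \subset J -> J = I \/ J = setT].

Definition chain_ring (A : finComNzRingType) : Prop :=
  forall I J : {set A}, is_ideal I -> is_ideal J ->
    I \subset J \/ J \subset I.

(* c may be composite here, whereas [pchar A] only records prime values. *)
Definition has_char (A : nzRingType) (c : nat) : Prop :=
  forall i : nat, (i%:R == 0 :> A) = (c %| i)%N.

(* F together with pi is a model of the residue field A / <g>. *)
Definition residue_map (A : finComNzRingType) (g : A)
    (F : finFieldType) (pi : {rmorphism A -> F}) : Prop :=
  (forall y : F, exists x : A, pi x = y) /\
  (forall x : A, (pi x == 0) = (x \in pideal g)).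

Definition basic_irreducible (A : finComNzRingType) (F : finFieldType)
    (pi : {rmorphism A -> F}) (q : {poly A}) : Prop :=
  irreducible_poly (map_poly pi q).

(* The library's coprimep needs coefficients in an integral domain. *)
Definition poly_coprime (A : comNzRingType) (q1 q2 : {poly A}) : Prop :=
  exists u v : {poly A}, u * q1 + v * q2 = 1.

(* The set {0, 1, z, ..., z^(N-1)}. *)
Definition teich (A : finComNzRingType) (z : A) (N : nat) : {set A} :=
  0 |: [set z ^+ (i : 'I_N) | i : 'I_N].

Definition invertible (A : comNzRingType) (x : A) : Prop :=
  exists y : A, x * y = 1.

Definition polys_over_lt (A : finComNzRingType) (T : {set A}) (d : nat) :
    pred {poly A} :=
  fun a => (size a <= d)%N && all [in T] a.

Definition zero_or_unit_expansion (A : finComNzRingType) (T : {set A})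
    (h f : {poly A}) (d N : nat) (G : {poly %/ h}) : Prop :=
  G = 0 \/
  invertible G /\
  exists a : nat -> {poly A},
    (forall i, (i < N)%N -> polys_over_lt T d (a i)) /\
    G = in_qpoly h (\sum_(i < N) a i * f ^+ i).

Definition gen_elt (A : finComNzRingType) (g : A) (h f : {poly A})
    (w t : nat) (G : {poly %/ h}) : {poly %/ h} :=
  in_qpoly h f ^+ w + g *: (in_qpoly h f ^+ t * G).

Definition gamma_pow (A : finComNzRingType) (g : A) (h f : {poly A})
    (i : nat) : {poly %/ h} :=
  g *: in_qpoly h f ^+ i.

Definition least_gamma_exp (A : finComNzRingType) (g : A) (h f : {poly A})
    (I : {set {poly %/ h}}) (kappa : nat) : Prop :=
  gamma_pow g h f kappa \in I /\
  forall i, gamma_pow g h f i \in I -> (kappa <= i)%N.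

(* N is p^s. When G = 0 the exponent t is irrelevant and left unconstrained. *)
Definition type_III (A : finComNzRingType) (g : A) (T : {set A})
    (h f : {poly A}) (d N w t : nat) (G : {poly %/ h}) : Prop :=
  exists kappa : nat,
    [/\ least_gamma_exp g f (pideal (gen_elt g f w t G)) kappa,
        (0 < w < N)%N,
        G != 0 -> (t < kappa)%N
      & zero_or_unit_expansion T f d (kappa - t) G].

Definition type_IV (A : finComNzRingType) (g : A) (T : {set A})
    (h f : {poly A}) (d N w t mu : nat) (G : {poly %/ h}) : Prop :=
  exists kappa : nat,
    [/\ least_gamma_exp g f (pideal (gen_elt g f w t G)) kappa,
        [/\ (mu < kappa)%N, (kappa <= w)%N & (w < N)%N],
        G != 0 -> (t < mu)%N
      & zero_or_unit_expansion T f d (mu - t) G].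

(* Main.v *)
Require Import Defs.
From HB Require Import structures.
From mathcomp Require Import all_boot all_order all_algebra.
From mathcomp Require Import zify ring.

Set Implicit Arguments.
Unset Strict Implicit.
Unset Printing Implicit Defensive.

Import GRing.Theory.
Local Open Scope ring_scope.

(** Write u for the class of f_j in K = K_j, N = p^s and Q = p^(m d_j).
Multiplication by gamma has kernel and image gamma K, so it identifies gamma K
with K / gamma K = F[x] / (f^N), f being the reduction of f_j. As f is
irreducible, this is a chain ring of length N with uniformizer u and with Q
elements in its residue field: every nonzero element of gamma K is gamma u^i
times a unit, and gamma u^i K has Q^(N - i) elements.

For an ideal I, multiplication by gamma maps I onto gamma I = gamma u^omega K
with kernel I /\ gamma K = gamma u^kappa K, whence
|I| = Q^((N - kappa) + (N - omega)) ([card_ideal_levels]). In each type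
omega can be read off the generators, and the work is to find the torsion
exponent kappa. For the ideal generated by
u^omega + gamma b, the elements c with c u^omega in gamma K are those of
u^(N - omega) K + gamma K. Hence, with u^N = gamma w, the part of the ideal
inside gamma K is generated by gamma u^omega and
gamma (w + u^(N - omega) b), and kappa is the minimum of omega and of the
u-adic valuation of w + u^(N - omega) b modulo gamma ([card_pideal_gen]).
In Type IV the second generator imposes kappa = mu ([card_pideal2_gen]).

It remains to know w, up to gamma. In characteristic p both the k_i and the
f_i^N are monic coprime factors of x^(n N) - alpha = (x^n - alpha_0)^N with
the same reductions, so k_j = f_j^N by uniqueness of Hensel lifts
([monic_factorization_unique]) and w is zero. In characteristic p^2 one has
w = - u^P M with P = p^(s - 1) and M a unit, and with b = u^t G the cases of
the theorem compare the exponents N - omega + t and P in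
u^(N - omega + t) G - u^P M; cancellation can only occur when they agree, and
then A_G and delta measure it. *)

(** * Ideals and units of a finite commutative ring *)

Section Ideals.

Variable A : finComNzRingType.
Implicit Types (a b x y : A) (I : {set A}).

Lemma pidealP a x : reflect (exists c, x = c * a) (x \in pideal a).
Proof.
apply: (iffP imsetP) => [[c _ ->]|[c ->]]; first by exists c.
by exists c.
Qed.

Lemma pideal2P a b x :
  reflect (exists c e, x = c * a + e * b) (x \in pideal2 a b).
Proof.
apply: (iffP imset2P) => [[c e _ _ ->]|[c [e ->]]]; first by exists c, e.
by exists c e.
Qed.

Lemma is_ideal_pideal a : is_ideal (pideal a).
Proof.
split=> [|c x y /pidealP[b ->] /pidealP[e ->]].
  by apply/pidealP; exists 0; rewrite mul0r.
by apply/pidealP; exists (c * b + e); rewrite mulrDl -mulrA.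
Qed.

Lemma ideal0 I : is_ideal I -> 0 \in I.
Proof. by case. Qed.

Lemma idealMl I c x : is_ideal I -> x \in I -> c * x \in I.
Proof. by case=> I0 I1 xI; have := I1 c x 0 xI I0; rewrite addr0. Qed.

Lemma idealD I x y : is_ideal I -> x \in I -> y \in I -> x + y \in I.
Proof. by case=> _ I1 xI yI; have := I1 1 x y xI yI; rewrite scale1r. Qed.

Lemma idealB I x y : is_ideal I -> x \in I -> y \in I -> x - y \in I.
Proof.
move=> hI xI yI; apply: idealD => //.
by rewrite -mulN1r; apply: idealMl.
Qed.

(** Multiplication by g is additive, so all its fibres over g I are translates
of its kernel in I. *)
Lemma card_ideal_mul (g : A) I : is_ideal I ->
  #|I| = (#|[set x in I | g * x == 0]%R| * #|[set g * x | x in I]%R|)%N.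
Proof.
move=> hI; rewrite -[LHS]sum1_card.
rewrite (partition_big_imset (fun x => g * x)) /=.
rewrite mulnC -sum_nat_const; apply: eq_bigr => _ /imsetP[z zI ->].
rewrite sum1dep_card.
have -> : [set x in I | g * x == g * z]
          = [set z + x | x in [set x in I | g * x == 0]].
  apply/setP=> x; apply/idP/imsetP.
    rewrite inE => /andP[xI /eqP xz]; exists (x - z); last by rewrite addrC subrK.
    by rewrite inE idealB // mulrBr xz subrr eqxx.
  case=> y; rewrite !inE => /andP[yI /eqP y0] ->.
  by rewrite idealD //= mulrDr y0 addr0 eqxx.
by rewrite card_imset //; apply: addrI.
Qed.

Lemma invertibleN x : invertible x -> invertible (- x).
Proof. by move=> [a xa]; exists (- a); rewrite mulrNN. Qed.

Lemma invertible_mull x y : invertible (x * y) -> invertible x.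
Proof. by move=> [a xa]; exists (y * a); rewrite mulrA. Qed.

Lemma invertible1_sub_nilpotent x n : x ^+ n = 0 -> invertible (1 - x).
Proof.
move=> xn0; exists (\sum_(i < n) x ^+ i).
by have := subrX1 x n; rewrite xn0 sub0r => /(congr1 -%R); rewrite opprK -mulNr opprB.
Qed.

(** Modulo g and u the element x has inverse y, and both g and u are nilpotent:
multiplying by 1 - g c removes g c, and a geometric series removes z u. *)
Lemma invertible_mod_maximal (g u w : A) N x y z c :
  g * g = 0 -> u ^+ N = g * w -> x * y + z * u = 1 + g * c -> invertible x.
Proof.
move=> gg uN E; apply: (@invertible_mull x (y * (1 - g * c))).
have -> : x * (y * (1 - g * c)) = 1 - z * (1 - g * c) * u.
  have -> : x * (y * (1 - g * c)) = (x * y + z * u - z * u) * (1 - g * c).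
    by ring.
  rewrite E; have -> : (1 + g * c - z * u) * (1 - g * c)
     = 1 - z * (1 - g * c) * u - (g * g) * c * c by ring.
  by rewrite gg !mul0r subr0.
apply: (@invertible1_sub_nilpotent _ (N + N)).
by rewrite exprMn [u ^+ _]exprD uN mulrACA gg mul0r mulr0.
Qed.

End Ideals.

(** * Square-zero extensions of a finite chain ring by itself *)

(** A ring A with g A isomorphic to A / g A, a chain ring of length N with
uniformizer u and with Q elements in its residue field. The valuation is
expressed on g A instead of A / g A, so that no quotient ring has to be
formed. The element w, defined up to g A, records how far u^N is from zero. *)
Record gamma_chain (A : finComNzRingType) (g u w : A) (N Q : nat) : Prop :=
  GammaChain {
    gamma_chain_sqr : g * g = 0;
    gamma_chain_ann : forall a, g * a = 0 -> a \in pideal g;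
    gamma_chain_val : forall b, g * b = 0 \/
      exists i e, [/\ (i < N)%N, invertible e & g * b = g * (u ^+ i * e)];
    gamma_chain_pow : u ^+ N = g * w;
    gamma_chain_card : forall i, (i <= N)%N ->
      #|pideal (g * u ^+ i)| = (Q ^ (N - i))%N;
    gamma_chain_gt1 : (1 < Q)%N
  }.

Section GammaChain.

Variables (A : finComNzRingType) (g u w : A) (N Q : nat).
Hypothesis chainA : gamma_chain g u w N Q.
Let gg := gamma_chain_sqr chainA.

Lemma gamma_pow_ge i : (N <= i)%N -> g * u ^+ i = 0.
Proof.
move=> /subnK <-; rewrite addnC exprD (gamma_chain_pow chainA).
by rewrite !mulrA gg !mul0r.
Qed.

(** Here the cardinals enter: the ideal of g u^i has Q^(N - i) > 1 elements. *)
Lemma gamma_pow_lt i : (i < N)%N -> g * u ^+ i != 0.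
Proof.
move=> ltiN; apply/eqP=> gu0.
have := gamma_chain_card chainA (ltnW ltiN).
have -> : pideal (g * u ^+ i) = [set 0].
  apply/setP=> x; rewrite gu0 inE; apply/pidealP/eqP => [[c ->]|->].
    by rewrite mulr0.
  by exists 0; rewrite mul0r.
rewrite cards1 => Qexp.
by have := ltn_expl (N - i) (gamma_chain_gt1 chainA); lia.
Qed.

Lemma gamma_pow_mem i j : (j <= i)%N ->
  forall c, g * (u ^+ i * c) \in pideal (g * u ^+ j).
Proof.
move=> /subnK <- c; apply/pidealP; exists (u ^+ (i - j) * c).
by rewrite exprD; ring.
Qed.

(** Cancellation in the chain ring A / g A: an element whose product with u^i is
zero has valuation at least N - i. *)
Lemma gamma_kills_pow c i : g * c * u ^+ i = 0 -> (i <= N)%N ->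
  exists c' c'', c = u ^+ (N - i) * c' + g * c''.
Proof.
move=> gcu leiN.
have [gc0|[l [e [ltlN [e' ee'] gc]]]] := gamma_chain_val chainA c.
  have /pidealP[c'' ->] := gamma_chain_ann chainA gc0.
  by exists 0, c''; rewrite mulr0 add0r mulrC.
have leNli : (N <= i + l)%N.
  rewrite leqNgt; apply/negP=> /gamma_pow_lt/eqP; apply.
  have -> : g * u ^+ (i + l) = g * (u ^+ l * e) * u ^+ i * e'.
    rewrite -[LHS]mulr1 -ee' exprD; ring.
  by rewrite -gc gcu mul0r.
have lel : (N - i <= l)%N by lia.
have /(gamma_chain_ann chainA)/pidealP[c'' E] :
    g * (c - u ^+ (N - i) * (u ^+ (l - (N - i)) * e)) = 0.
  by rewrite mulrBr gc -{1}(subnKC lel) exprD; ring.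
exists (u ^+ (l - (N - i)) * e), c''.
by rewrite [g * _]mulrC -E addrC subrK.
Qed.

(** The exponents omega and kappa are the valuations of the image of I in
A / g A and of its torsion part, the elements of A / g A sent into I by g. *)
Lemma card_ideal_levels (I : {set A}) kappa omega :
  is_ideal I -> (kappa <= N)%N -> (omega <= N)%N ->
  (forall x, x \in I -> g * x = 0 -> x \in pideal (g * u ^+ kappa)) ->
  g * u ^+ kappa \in I ->
  (forall x, x \in I -> g * x \in pideal (g * u ^+ omega)) ->
  (exists2 x, x \in I & g * x = g * u ^+ omega) ->
  #|I| = (Q ^ (N - kappa + (N - omega)))%N.
Proof.
move=> hI lek leo torI gkI topI [y yI gy].
rewrite (card_ideal_mul g hI) expnD -!(gamma_chain_card chainA) //.
congr (_ * _)%N; congr #|pred_of_set _|; apply/setP=> x; rewrite ?inE.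
  apply/andP/idP => [[xI /eqP]|/pidealP[c ->]]; first exact: torI.
  by split; [apply: idealMl|rewrite mulrCA !mulrA -[c * g * g]mulrA gg mulr0 mul0r].
apply/imsetP/idP=> [[z zI ->]|/pidealP[c ->]]; first exact: topI.
by exists (c * y); [apply: idealMl|rewrite [RHS]mulrCA gy].
Qed.

Lemma card_gamma_chain : #|A| = (Q ^ (N + N))%N.
Proof.
rewrite -cardsT -{1 2}[N]subn0; apply: card_ideal_levels => //.
- by split=> [|c x y _ _]; rewrite in_setT.
- move=> x _ /(gamma_chain_ann chainA); by rewrite expr0 mulr1.
- by rewrite inE.
- by move=> x _; rewrite expr0 mulr1; apply/pidealP; exists x; rewrite mulrC.
- by exists 1; rewrite ?inE // expr0.
Qed.

Lemma gamma_gen omega b : g * (u ^+ omega + g * b) = g * u ^+ omega.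
Proof. by rewrite mulrDr [g * (g * b)]mulrA gg mul0r addr0. Qed.

(** Multiplying the generator by u^(N - omega) kills its image modulo g; what
remains is g (w + u^(N - omega) b). By cancellation, every torsion element of
the ideal comes from this element and from g u^omega. *)
Lemma card_pideal_gen omega v b e : (omega <= N)%N -> invertible e ->
  g * (w + u ^+ (N - omega) * b) = g * (u ^+ v * e) ->
  #|pideal (u ^+ omega + g * b)|
    = (Q ^ (N - minn omega v + (N - omega)))%N.
Proof.
move=> leoN [e' ee'] E; set a := _ + _.
have ua : u ^+ (N - omega) * a = g * (u ^+ v * e).
  rewrite -E mulrDr -exprD subnK // (gamma_chain_pow chainA); ring.
apply: card_ideal_levels; first exact: is_ideal_pideal.
- by rewrite geq_min leoN.
- by [].
- move=> x /pidealP[c ->] gca.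
  have /gamma_kills_pow[//|c' [c'' ->]] : g * c * u ^+ omega = 0.
    by rewrite -gca mulrCA /a gamma_gen; ring.
  have -> : (u ^+ (N - omega) * c' + g * c'') * a
      = c' * (u ^+ (N - omega) * a) + (g * a) * c'' by ring.
  rewrite ua /a gamma_gen -[g * _ * c'']mulrA.
  apply: idealD; [exact: is_ideal_pideal| |].
    by apply: idealMl; [exact: is_ideal_pideal|apply: gamma_pow_mem; lia].
  by apply: gamma_pow_mem; lia.
- rewrite /minn; case: ifP => _; apply/pidealP.
    by exists g; rewrite gamma_gen.
  exists (e' * u ^+ (N - omega)).
  rewrite -mulrA ua -[LHS]mulr1 -ee'; ring.
- move=> x /pidealP[c ->]; apply/pidealP; exists c.
  by rewrite mulrCA gamma_gen.
- by exists a; [apply/pidealP; exists 1; rewrite mul1r|apply: gamma_gen].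
Qed.

(** The case of infinite valuation, covered by capping the valuation at N. *)
Lemma card_pideal_gen0 omega b : (omega <= N)%N ->
  g * (w + u ^+ (N - omega) * b) = 0 ->
  #|pideal (u ^+ omega + g * b)| = (Q ^ (N - omega + (N - omega)))%N.
Proof.
move=> leoN E; rewrite (@card_pideal_gen omega N b 1) //.
- by rewrite (minn_idPl leoN).
- by exists 1; rewrite mulr1.
- by rewrite E mulrA gamma_pow_ge // mul0r.
Qed.

(** u lies in the maximal ideal. *)
Lemma invertibleD_u e c : invertible e -> invertible (e + u * c).
Proof.
move=> [e' ee'].
apply: (@invertible_mod_maximal _ g u w N _ e' (- c * e') 0) => //.
  exact: gamma_chain_pow chainA.
by rewrite -ee'; ring.
Qed.

(** Valuation of w + u^(N - omega + t) G when w = - u^P M with M a unit: the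
smaller of the exponents P and N - omega + t wins, and when they are equal the
difference M - G decides. *)
Section TypeThree.

Variables (P omega t : nat) (M G : A).
Hypotheses (wE : w = - (u ^+ P * M)) (M_unit : invertible M).
Hypothesis leoN : (omega <= N)%N.

Local Notation I := (pideal (u ^+ omega + g * (u ^+ t * G))).

Lemma card_typeIII_G_small : invertible G -> (N - omega + t < P)%N ->
  #|I| = (Q ^ (N - minn omega (N - omega + t) + (N - omega)))%N.
Proof.
move=> G_unit ltP.
apply: (@card_pideal_gen _ _ _ (G + u * - (u ^+ (P - (N - omega + t)).-1 * M))).
- by [].
- exact: invertibleD_u.
rewrite wE; congr (_ * _).
have -> : u ^+ P = u ^+ (N - omega + t) * u * u ^+ (P - (N - omega + t)).-1.
  by rewrite -exprSr -exprD; congr (_ ^+ _); lia.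
rewrite exprD; ring.
Qed.

Lemma card_typeIII_G_large : G = 0 \/ (P < N - omega + t)%N ->
  #|I| = (Q ^ (N - minn omega P + (N - omega)))%N.
Proof.
move=> G_large.
have [c cE] : exists c, u ^+ (N - omega) * (u ^+ t * G) = u ^+ P * (u * c).
  case: G_large => [->|ltP]; first by exists 0; rewrite !mulr0.
  exists (u ^+ (N - omega + t - P).-1 * G); rewrite !mulrA -!exprD -exprSr -exprD.
  by congr (_ ^+ _ * _); lia.
apply: (@card_pideal_gen _ _ _ (- M + u * c)) => //.
  exact/invertibleD_u/invertibleN.
by rewrite cE wE; ring.
Qed.

Lemma card_typeIII_G_equal delta B : (N - omega + t = P)%N ->
  g * (M - G) = g * (u ^+ delta * B) -> invertible B ->
  #|I| = (Q ^ (N - minn omega (P + delta) + (N - omega)))%N.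
Proof.
move=> eqP E B_unit.
apply: (@card_pideal_gen _ _ _ (- B)) => //; first exact: invertibleN.
have -> : g * (w + u ^+ (N - omega) * (u ^+ t * G)) = - (u ^+ P * (g * (M - G))).
  by rewrite wE -eqP exprD; ring.
by rewrite E exprD; ring.
Qed.

Lemma card_typeIII_G_eq_M : (N - omega + t = P)%N -> g * (M - G) = 0 ->
  #|I| = (Q ^ (N - omega + (N - omega)))%N.
Proof.
move=> eqP E; apply: card_pideal_gen0 => //.
have -> : g * (w + u ^+ (N - omega) * (u ^+ t * G)) = - (u ^+ P * (g * (M - G))).
  by rewrite wE -eqP exprD; ring.
by rewrite E mulr0 oppr0.
Qed.

End TypeThree.

(** Adding g u^mu to the ideal leaves its image modulo g unchanged and, mu being
at most the torsion exponent of the first generator, makes mu the torsion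
exponent. *)
Lemma card_pideal2_gen omega mu b : (mu <= omega)%N -> (omega <= N)%N ->
  (forall i, g * u ^+ i \in pideal (u ^+ omega + g * b) -> (mu <= i)%N) ->
  #|pideal2 (u ^+ omega + g * b) (g * u ^+ mu)|
    = (Q ^ (N - mu + (N - omega)))%N.
Proof.
set a := u ^+ omega + _ => lemo leoN least.
apply: card_ideal_levels => //.
- split=> [|c x y /pideal2P[c1 [c2 ->]] /pideal2P[c3 [c4 ->]]].
    by apply/pideal2P; exists 0, 0; rewrite !mul0r addr0.
  apply/pideal2P; exists (c * c1 + c3), (c * c2 + c4).
  rewrite [c *: _](_ : _ = c * (c1 * a + c2 * (g * u ^+ mu))) //; ring.
- exact: leq_trans leoN.
- move=> x /pideal2P[c [f ->]] gx.
  apply: idealD; [exact: is_ideal_pideal| |]; last first.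
    by apply/pidealP; exists f.
  have /(gamma_chain_ann chainA)/pidealP[y cay] : g * (c * a) = 0.
    rewrite -gx; have -> : g * (c * a + f * (g * u ^+ mu))
       = g * (c * a) + (g * g) * (f * u ^+ mu) by ring.
    by rewrite gg mul0r addr0.
  rewrite mulrC in cay; rewrite mulrC cay [y * g]mulrC.
  have [->|[i [e [_ [e' ee'] gy]]]] := gamma_chain_val chainA y.
    exact/ideal0/is_ideal_pideal.
  rewrite gy; apply: gamma_pow_mem; apply: least; apply/pidealP.
  exists (e' * c).
  rewrite -mulrA [c * a]mulrC cay [y * g]mulrC gy -[LHS]mulr1 -ee'; ring.
- by apply/pideal2P; exists 0, 1; rewrite mul0r add0r mul1r.
- move=> x /pideal2P[c [f ->]]; apply/pidealP; exists c.
  have -> : g * (c * a + f * (g * u ^+ mu))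
       = c * (g * a) + (g * g) * (f * u ^+ mu) by ring.
  by rewrite gg mul0r addr0 /a gamma_gen.
- exists a; last exact: gamma_gen.
  by apply/pideal2P; exists 1, 0; rewrite mul0r addr0 mul1r.
Qed.

End GammaChain.

(** * Polynomials modulo gamma *)

Lemma coprimep_map_poly (R : finComNzRingType) (F : fieldType)
    (pi : {rmorphism R -> F}) (a b : {poly R}) :
  poly_coprime a b -> coprimep (map_poly pi a) (map_poly pi b).
Proof.
move=> [u [v E]]; apply/Bezout_coprimepP.
exists (map_poly pi u, map_poly pi v) => /=.
by rewrite -!rmorphM -rmorphD E rmorph1 eqpxx.
Qed.

Lemma exact_dvdp_exp (F : fieldType) (q a : {poly F}) N : ~~ (q ^+ N %| a) ->
  exists2 i, (i < N)%N & (q ^+ i %| a) && ~~ (q ^+ i.+1 %| a).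
Proof.
elim: N => [|N IH]; first by rewrite expr0 dvd1p.
case: (boolP (q ^+ N %| a)) => [dvN ndvN|/IH[i ltiN hi] _].
  by exists N; rewrite ?ltnSn ?dvN.
by exists i; rewrite // ltnW.
Qed.

Lemma exprBn_pchar (R : comNzRingType) p s (x y : R) : p \in [pchar R] ->
  (x - y) ^+ (p ^ s) = x ^+ (p ^ s) - y ^+ (p ^ s).
Proof.
move=> pR; apply/eqP; rewrite eq_sym subr_eq -exprDn_pchar ?subrK //.
by rewrite pnatX (eq_pnat _ (pcharf_eq pR)) pnat_id ?(pcharf_prime pR).
Qed.

Section Residue.

Variables (R : finComNzRingType) (gamma : R).
Variables (F : finFieldType) (pi : {rmorphism R -> F}).
Hypotheses (gamma_neq0 : gamma != 0) (gamma_sq : gamma ^+ 2 = 0).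
Hypothesis (pi_res : residue_map gamma pi).

Implicit Types a b : {poly R}.

Local Notation "a ^pi" := (map_poly pi a) (at level 2, format "a ^pi").

(** An element c outside the maximal ideal is invertible up to gamma y, and
gamma kills gamma y; so gamma c = 0 would force gamma = 0. *)
Lemma gammaM_eq0 (c : R) : (gamma * c == 0) = (pi c == 0).
Proof.
have [surj ker] := pi_res; apply/eqP/eqP => [gc0|/eqP].
  apply/eqP; apply: contraNT gamma_neq0 => pic_neq0.
  have [c' pic'] := surj (pi c)^-1.
  have /eqP : pi (1 - c * c') = 0.
    by rewrite rmorphB rmorph1 rmorphM pic' divff // subrr.
  rewrite ker => /pidealP[y E].
  have : gamma * (1 - c * c') = gamma ^+ 2 * y by rewrite E; ring.
  by rewrite gamma_sq mul0r mulrBr mulrA gc0 mul0r subr0 mulr1 => ->.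
by rewrite ker => /pidealP[y ->]; rewrite mulrCA -expr2 gamma_sq mulr0.
Qed.

Lemma gammaZ_eq0 a : (gamma *: a == 0) = (a^pi == 0).
Proof.
apply/eqP/eqP=> /polyP E; apply/polyP => i; move: (E i);
  rewrite coefZ coef_map !coef0 => /eqP Ei; apply/eqP.
  by rewrite -gammaM_eq0.
by rewrite gammaM_eq0.
Qed.

Lemma map_pi_gammaZ a : (gamma *: a)^pi = 0.
Proof.
apply/eqP; rewrite -gammaZ_eq0 scalerA -expr2 gamma_sq.
by rewrite scale0r.
Qed.

Lemma map_pi_lift : {lift : {poly F} -> {poly R} |
  forall y, (lift y)^pi = y}.
Proof.
pose s y := odflt 0 [pick x | pi x == y].
have sK y : pi (s y) = y.
  rewrite /s; case: pickP => [x /eqP //|none].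
  by have [x /eqP] := pi_res.1 y; rewrite none.
exists (fun y => \poly_(i < size y) s y`_i) => y; apply/polyP=> i.
rewrite coef_map coef_poly; case: ltnP => [_|/leq_sizeP/(_ i (leqnn i)) ->].
  exact: sK.
by rewrite raddf0.
Qed.

Lemma map_pi_eq0 a : a^pi = 0 -> exists b, a = gamma *: b.
Proof.
move=> a0; pose s (x : R) := odflt 0 [pick y | x == gamma * y].
have sK x : pi x = 0 -> x = gamma * s x.
  move/eqP; rewrite (pi_res.2 x) /s => /pidealP[c E].
  by case: pickP => [y /eqP //|/(_ c)]; rewrite E mulrC eqxx.
exists (\poly_(i < size a) s a`_i); apply/polyP=> i.
rewrite coefZ coef_poly; case: ltnP => [_|/leq_sizeP/(_ i (leqnn i)) ->].
  by apply: sK; rewrite -coef_map a0 coef0.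
by rewrite mulr0.
Qed.

Lemma map_pi_eq a b : a^pi = b^pi -> exists c, a = b + gamma *: c.
Proof.
move=> E; have [|c Ec] := @map_pi_eq0 (a - b); first by rewrite rmorphB /= E subrr.
by exists c; rewrite -Ec addrC subrK.
Qed.

Lemma size_map_monic a : a \is monic -> size a^pi = size a.
Proof. by move=> /monicP a1; rewrite size_map_poly_id0 // a1 rmorph1 oner_eq0. Qed.

(** Uniqueness in Hensel's lemma, to first order in gamma. With
a' = a + gamma c and b' = b + gamma e, the equality of the products reads
a e + c b = 0 modulo gamma, so a divides c there; but a and a' are both monic,
so c has smaller degree than a modulo gamma. *)
Lemma monic_factor_unique a a' b b' : a \is monic -> a' \is monic ->
  a^pi = a'^pi -> b^pi = b'^pi -> a * b = a' * b' ->
  coprimep a^pi b^pi -> a = a'.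
Proof.
move=> am am' Ea Eb E cop.
have [c Ec] := map_pi_eq (esym Ea); have [e Ee] := map_pi_eq (esym Eb).
have sza : size a' = size a by rewrite -!size_map_monic // Ea.
rewrite Ec; suff /eqP -> : gamma *: c == 0 by rewrite addr0.
rewrite gammaZ_eq0.
have dvc : a^pi %| c^pi.
  rewrite -(Gauss_dvdpl _ cop).
  have : (a * e + c * b)^pi == 0.
    rewrite -gammaZ_eq0.
    have : a' * b' - a * b = gamma *: (a * e + c * b).
      rewrite Ec Ee -!mul_polyC.
      have -> : (a + gamma%:P * c) * (b + gamma%:P * e) - a * b =
        gamma%:P * (a * e + c * b) + gamma%:P ^+ 2 * c * e by ring.
      by rewrite -rmorphXn gamma_sq rmorph0 !mul0r addr0.
    by rewrite E subrr => <-.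
  rewrite rmorphD !rmorphM /= addr_eq0 => /eqP E'.
  by rewrite -dvdpNr -E' dvdp_mulr.
apply: contraT => c_neq0; move: (dvdp_leq c_neq0 dvc).
rewrite (size_map_monic am) leqNgt.
suff -> : (size c^pi < size a)%N by [].
have sza_gt0 : (0 < size a)%N by rewrite size_poly_gt0 monic_neq0.
rewrite -(prednK sza_gt0) ltnS; apply/leq_sizeP => i hi.
apply/eqP; rewrite coef_map /= -gammaM_eq0 -coefZ.
have -> : gamma *: c = a' - a by rewrite Ec addrC addKr.
rewrite coefB; case: (leqP (size a) i) => [h|h].
  by rewrite !nth_default ?subrr ?sza.
have -> : i = (size a).-1 by lia.
by rewrite -{1}sza -!lead_coefE (monicP am) (monicP am') subrr.
Qed.

Lemma monic_factorization_unique r (a b : 'I_r -> {poly R}) :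
  (forall i, a i \is monic) -> (forall i, b i \is monic) ->
  (forall i, (a i)^pi = (b i)^pi) ->
  (forall i i', i != i' -> coprimep (a i)^pi (a i')^pi) ->
  \prod_i a i = \prod_i b i -> forall i, a i = b i.
Proof.
move=> am bm ab cop E i; move: E; rewrite (bigD1 i) //= [RHS](bigD1 i) //= => E.
apply: monic_factor_unique E _; rewrite ?rmorph_prod //=.
  exact: eq_bigr.
elim/big_ind: _ => [|x y hx hy|i' ne]; first exact: coprimep1.
  by rewrite coprimepMr hx.
by apply: cop; rewrite eq_sym.
Qed.

(** * The quotient by a lift of a power of an irreducible polynomial *)

Section Quotient.

Variables (k : {poly R}).
Hypotheses (k_monic : k \is monic) (k_size : (1 < size k)%N).

Lemma in_qpoly_eq0 a : in_qpoly k a = 0 -> exists b, a = b * k.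
Proof.
move/(congr1 val) => /=.
have -> : mk_monic k = k by rewrite /mk_monic k_size k_monic.
move=> E; exists (Pdiv.Ring.rdivp a k).
by rewrite [LHS](Pdiv.RingMonic.rdivp_eq k_monic) E addr0.
Qed.

Lemma in_qpoly_modulus : in_qpoly k k = 0.
Proof.
apply: val_inj => /=; have -> : mk_monic k = k by rewrite /mk_monic k_size k_monic.
by rewrite Pdiv.RingMonic.rmodpp.
Qed.

(** This is the isomorphism between gamma K and F[x] / (k mod gamma), K being
R[x] / (k). *)
Lemma gamma_in_qpoly_eq0 a : (gamma *: in_qpoly k a == 0) = (k^pi %| a^pi).
Proof.
apply/eqP/idP => [|/dvdpP[c E]].
  rewrite -in_qpolyZ => /in_qpoly_eq0[b E].
  have /eqP : b^pi * k^pi = 0 by rewrite -rmorphM -E /= map_pi_gammaZ.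
  rewrite mulf_eq0 [k^pi == 0]negbTE; last by rewrite monic_neq0 ?monic_map.
  rewrite orbF => /eqP /map_pi_eq0[b' Eb'].
  have /eqP : gamma *: (a - b' * k) = 0.
    by rewrite scalerBr E Eb' -scalerAl subrr.
  rewrite gammaZ_eq0 rmorphB rmorphM /= subr_eq0 => /eqP ->.
  exact: dvdp_mull.
have [lift liftK] := map_pi_lift.
have [e ->] : exists e, a = lift c * k + gamma *: e.
  by apply: map_pi_eq; rewrite E rmorphM /= liftK.
rewrite in_qpolyD in_qpolyM in_qpoly_modulus mulr0 add0r in_qpolyZ.
by rewrite scalerA -expr2 gamma_sq scale0r.
Qed.

Variables (f g : {poly R}) (d N : nat).
Hypotheses (f_monic : f \is monic) (f_irr : basic_irreducible pi f).
Hypotheses (f_size : size f = d.+1) (k_def : k = f ^+ N + gamma *: g).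

Local Notation K := {poly %/ k}.

Lemma in_qpoly_val (b : K) : in_qpoly k (val b) = b.
Proof. exact: val_inj (in_qpoly_small (size_mk_monic b)). Qed.

Lemma map_pi_k : k^pi = f^pi ^+ N.
Proof. by rewrite k_def rmorphD rmorphXn /= map_pi_gammaZ addr0. Qed.

Lemma d_gt0 : (0 < d)%N.
Proof. by have [] := f_irr; rewrite size_map_monic // f_size ltnS. Qed.

Lemma f_pi_neq0 : f^pi != 0.
Proof. by rewrite monic_neq0 ?monic_map. Qed.

(** The class of gamma a f^i is determined by the remainder of a, reduced modulo
gamma, in the division by f^(N - i). *)
Lemma card_gamma_level i : (i <= N)%N ->
  #|pideal (gamma%:A * in_qpoly k f ^+ i : K)| = ((#|F| ^ d) ^ (N - i))%N.
Proof.
move=> leiN; rewrite -expnM -card_npoly; have [lift liftK] := map_pi_lift.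
pose phi (v : {poly_(d * (N - i)) F}) : K :=
  gamma *: in_qpoly k (lift v * f ^+ i).
have phiE a v : gamma *: in_qpoly k (a * f ^+ i) = phi v <->
    f^pi ^+ (N - i) %| a^pi - polyn v.
  rewrite /phi; have -> : (f^pi ^+ (N - i) %| a^pi - polyn v)
      = (k^pi %| (a * f ^+ i - lift v * f ^+ i)^pi).
    rewrite rmorphB !rmorphM /= liftK rmorphXn /= -mulrBl map_pi_k.
    have -> : f^pi ^+ N = f^pi ^+ (N - i) * f^pi ^+ i by rewrite -exprD subnK.
    by rewrite dvdp_mul2r // expf_neq0 // f_pi_neq0.
  rewrite -gamma_in_qpoly_eq0 in_qpolyD -scaleN1r in_qpolyZ scaleN1r.
  rewrite scalerBr subr_eq0.
  by split=> [->|/eqP].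
have size_fN : size (f^pi ^+ (N - i)) = (d * (N - i)).+1.
  rewrite -[LHS]prednK ?size_exp ?size_map_monic ?f_size // size_poly_gt0 expf_neq0 //.
  exact: f_pi_neq0.
have size_v (v : {poly_(d * (N - i)) F}) : (size v < size (f^pi ^+ (N - i)))%N.
  by rewrite size_fN ltnS size_npoly.
have phi_inj : injective phi.
  move=> v v' /esym E; apply/val_inj/eqP => /=; rewrite -subr_eq0.
  have /phiE := esym E; rewrite liftK => dv; apply: contraT => nz.
  have := leq_trans (dvdp_leq nz dv) (size_polyD _ _).
  by rewrite size_polyN leqNgt gtn_max !size_v.
rewrite -(card_imset _ phi_inj).
congr #|pred_of_set _|; apply/setP=> x; apply/pidealP/imsetP => [[c ->]|[v _ ->]].
  have [v vE] : exists v : {poly_(d * (N - i)) F},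
      polyn v = (val c)^pi %% (f^pi ^+ (N - i)).
    have h : (val c)^pi %% (f^pi ^+ (N - i)) \is a poly_of_size (d * (N - i)).
      by rewrite qualifE /= -ltnS -size_fN ltn_modp expf_neq0 // f_pi_neq0.
    by exists (NPoly h).
  exists v => //; rewrite mulrCA mulr_algl -{1}(in_qpoly_val c).
  rewrite -rmorphXn -rmorphM; apply/phiE.
  by rewrite vE [X in X - _](divp_eq _ (f^pi ^+ (N - i))) addrK dvdp_mull.
exists (in_qpoly k (lift v)).
by rewrite mulrCA mulr_algl -rmorphXn -rmorphM.
Qed.

(** Since k = f^N + gamma g, the element w is the class of - g. *)
Lemma gamma_chain_qpoly :
  gamma_chain (gamma%:A : K) (in_qpoly k f) (- in_qpoly k g) N (#|F| ^ d).
Proof.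
have gg : (gamma%:A : K) * gamma%:A = 0.
  by rewrite mulr_algl scalerA -expr2 gamma_sq scale0r.
have uN : in_qpoly k f ^+ N = gamma%:A * - in_qpoly k g.
  rewrite mulr_algl scalerN -in_qpolyZ -rmorphXn /=.
  apply/eqP; rewrite -subr_eq0 opprK -in_qpolyD -k_def in_qpoly_modulus.
  exact: eqxx.
have ann (b : K) : gamma%:A * b = 0 -> b \in pideal (gamma%:A : K).
  rewrite mulr_algl -(in_qpoly_val b) => /eqP.
  rewrite gamma_in_qpoly_eq0 map_pi_k => /dvdpP[c E].
  have [lift liftK] := map_pi_lift.
  have [e ->] : exists e, val b = lift c * f ^+ N + gamma *: e.
    by apply: map_pi_eq; rewrite E rmorphM rmorphXn /= liftK.
  rewrite in_qpolyD in_qpolyM rmorphXn /= uN in_qpolyZ.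
  apply/pidealP; exists (- in_qpoly k (lift c) * in_qpoly k g + in_qpoly k e).
  rewrite -[gamma *: in_qpoly k e]mulr_algl; ring.
split=> //.
- move=> b; rewrite mulr_algl -(in_qpoly_val b).
  have [/eqP -> |] := boolP (gamma *: in_qpoly k (val b) == 0); first by left.
  rewrite gamma_in_qpoly_eq0 map_pi_k => /exact_dvdp_exp[i ltiN].
  case/andP=> /dvdpP[c E] ndv; right.
  have [lift liftK] := map_pi_lift.
  exists i, (in_qpoly k (lift c)); split=> //; last first.
    rewrite mulr_algl -rmorphXn -rmorphM; apply/eqP.
    rewrite -subr_eq0 -scalerBr -rmorphB gamma_in_qpoly_eq0.
    by rewrite rmorphB rmorphM rmorphXn /= liftK E mulrC subrr dvdp0.
  (* The Bezout relation between c and f lifts to one modulo gamma. *)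
  have cop : coprimep c f^pi.
    rewrite coprimep_sym irreducible_poly_coprime //.
    apply: contra ndv => dvc; rewrite E exprS.
    by rewrite dvdp_mul2r // expf_neq0 // f_pi_neq0.
  have /Bezout_eq1_coprimepP[[x y] /= Exy] := cop.
  have [e Ee] : exists e, lift x * lift c + lift y * f = 1 + gamma *: e.
    by apply: map_pi_eq; rewrite rmorphD !rmorphM rmorph1 /= !liftK.
  apply: (@invertible_mod_maximal _ _ _ _ _ _ (in_qpoly k (lift x))
            (in_qpoly k (lift y)) (in_qpoly k e) gg uN).
  by rewrite -!in_qpolyM -in_qpolyD mulrC Ee in_qpolyD in_qpoly1 in_qpolyZ mulr_algl.
- by move=> i; exact: card_gamma_level.
- exact: leq_ltn_trans d_gt0 (ltn_expl d (card_finNzRing_gt1 F)).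
Qed.

End Quotient.
End Residue.

(** * Cardinalities of the ideals *)

Theorem theorem3p6
  (R : finComNzRingType) (gamma : R)
  (F : finFieldType) (pi : {rmorphism R -> F})
  (p m n s : nat) (zeta alpha beta alpha0 : R)
  (r : nat) (d : 'I_r -> nat) (f g k M : 'I_r -> {poly R}) (j : 'I_r)
  (R_chain : chain_ring R)
  (gamma_max : maximal_ideal (pideal gamma))
  (gamma_neq0 : gamma != 0) (gamma_sq : gamma ^+ 2 = 0)
  (pi_res : residue_map gamma pi)
  (p_prime : prime p) (F_card : #|F| = (p ^ m)%N)
  (R_char : has_char R p \/ has_char R (p ^ 2))
  (zeta_ord : (p ^ m - 1).-primitive_root zeta)
  (n_gt0 : (0 < n)%N) (s_gt0 : (0 < s)%N) (np_coprime : coprime n p)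
  (alpha_T : alpha \in teich zeta (p ^ m - 1)) (alpha_neq0 : alpha != 0)
  (beta_T : beta \in teich zeta (p ^ m - 1))
  (alpha0_T : alpha0 \in teich zeta (p ^ m - 1))
  (alpha0_pow : alpha0 ^+ (p ^ s) = alpha)
  (f_prod : 'X^n - alpha0%:P = \prod_(i < r) f i)
  (f_monic : forall i, f i \is monic)
  (f_coprime : forall i i', i != i' -> poly_coprime (f i) (f i'))
  (f_irr : forall i, basic_irreducible pi (f i))
  (f_deg : forall i, size (f i) = (d i).+1)
  (k_prod : 'X^(n * p ^ s) - (alpha + gamma * beta)%:P = \prod_(i < r) k i)
  (k_def : forall i, k i = f i ^+ (p ^ s) + gamma *: g i)
  (k_monic : forall i, k i \is monic)
  (k_coprime : forall i i', i != i' -> poly_coprime (k i) (k i'))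
  (k_deg : forall i, size (k i) = (d i * p ^ s).+1)
  (beta_eq0 : beta = 0)
  (M_def : has_char R (p ^ 2) -> forall i,
     g i = f i ^+ (p ^ (s - 1)) * M i /\ poly_coprime (M i) (f i))
  (I : {set {poly %/ k j}}) (I_ideal : is_ideal I) :
  let T := teich zeta (p ^ m - 1) in
  (* (a) *)
  (I = [set 0] -> #|I| = 1%N)
  /\
  (* (b) *)
  (I = [set: {poly %/ k j}] -> #|I| = (p ^ (2 * m * d j * p ^ s))%N)
  /\
  (* (c) *)
  (forall tau : nat, (tau < p ^ s)%N ->
     I = pideal (gamma_pow gamma (k j) (f j) tau) ->
     #|I| = (p ^ (m * d j * (p ^ s - tau)))%N)
  /\
  (* (d) *)
  (forall (omega t : nat) (G : {poly %/ k j}),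
     type_III gamma T (f j) (d j) (p ^ s) omega t G ->
     I = pideal (gen_elt gamma (f j) omega t G) ->
     (has_char R p ->
        (G = 0 \/ G <> 0 /\ (2 * omega <= p ^ s + t)%N ->
           #|I| = (p ^ (2 * m * d j * (p ^ s - omega)))%N)
        /\
        (G <> 0 /\ (p ^ s + t < 2 * omega)%N ->
           #|I| = (p ^ (m * d j * (p ^ s - t)))%N))
     /\
     (has_char R (p ^ 2) ->
        let is_decomp (delta : nat) (A : {poly %/ k j}) :=
          [/\ (delta < p ^ s)%N, A = 0 \/ invertible A
            & gamma *: (in_qpoly (k j) (M j) - G)
              = gamma *: (in_qpoly (k j) (f j) ^+ delta * A)] in
        (exists delta A, is_decomp delta A)
        /\
        forall (delta : nat) (A : {poly %/ k j}), is_decomp delta A ->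
          (* (1) *)
          ([\/ G = 0 /\ (omega <= p ^ (s - 1))%N,
               [/\ G <> 0, (2 * omega <= p ^ s + t)%N,
                   (omega <= p ^ (s - 1))%N
                 & omega <> (p ^ s - p ^ (s - 1) + t)%N],
               A = 0 /\ omega = (p ^ s - p ^ (s - 1) + t)%N
             | [/\ A <> 0, omega = (p ^ s - p ^ (s - 1) + t)%N
                 & (p ^ s - p ^ (s - 1) <= delta)%N]
               \/
               [/\ A <> 0, omega = (p ^ s - p ^ (s - 1) + t)%N
                 & (p ^ s - p ^ (s - 1) + t <= p ^ (s - 1) + delta)%N]] ->
             #|I| = (p ^ (2 * m * d j * (p ^ s - omega)))%N)
          /\
          (* (2) *)
          ([/\ G <> 0, (p ^ s + t <= 2 * omega)%N
             & (p ^ s + t < p ^ (s - 1) + omega)%N] ->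
             #|I| = (p ^ (m * d j * (p ^ s - t)))%N)
          /\
          (* (3) *)
          (G = 0 /\ (p ^ (s - 1) < omega)%N
           \/ [/\ G <> 0, (p ^ (s - 1) <= omega)%N
                & (p ^ (s - 1) + omega < p ^ s + t)%N] ->
             #|I| = (p ^ (m * d j * (2 * p ^ s - omega - p ^ (s - 1))))%N)
          /\
          (* (4) *)
          ([/\ A <> 0, omega = (p ^ s - p ^ (s - 1) + t)%N
             & (p ^ (s - 1) + delta < omega)%N] ->
             #|I| = (p ^ (m * d j
                          * (2 * p ^ s - omega - p ^ (s - 1) - delta)))%N)))
  /\
  (* (e) *)
  (forall (omega t mu : nat) (G : {poly %/ k j}),
     type_IV gamma T (f j) (d j) (p ^ s) omega t mu G ->
     I = pideal2 (gen_elt gamma (f j) omega t G)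
                 (gamma_pow gamma (k j) (f j) mu) ->
     #|I| = (p ^ (m * d j * (2 * p ^ s - mu - omega)))%N).
Proof.
move=> T; set N := (p ^ s)%N; set P := (p ^ (s - 1))%N.
have N_gt0 : (0 < N)%N by rewrite expn_gt0 prime_gt0.
have ltPN : (P < N)%N by rewrite ltn_exp2l ?prime_gt1 //; lia.
have dj_gt0 : (0 < d j)%N by apply: d_gt0 (f_monic j) (f_irr j) (f_deg j).
have kj_size : (1 < size (k j))%N by rewrite k_deg ltnS muln_gt0 dj_gt0.
have chainK := gamma_chain_qpoly gamma_neq0 gamma_sq pi_res (k_monic j) kj_size
  (f_monic j) (f_irr j) (f_deg j) (k_def j).
set gK : {poly %/ k j} := gamma%:A in chainK.
set u := in_qpoly (k j) (f j) in chainK *.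
set w := - in_qpoly (k j) (g j) in chainK.
have QE e : ((#|F| ^ d j) ^ e = p ^ (m * d j * e))%N.
  by rewrite F_card -!expnM mulnA.
have sameE x y : x = y -> (p ^ (m * d j * x) = p ^ (m * d j * y))%N by move=> ->.
have twiceE x y : x = (y + y)%N ->
    (p ^ (m * d j * x) = p ^ (2 * m * d j * y))%N.
  by move=> ->; congr (_ ^ _)%N; rewrite addnn -mul2n -!mulnA; lia.
have scaleE (x : {poly %/ k j}) : gamma *: x = gK * x by rewrite mulr_algl.
have gpowE i : gamma_pow gamma (k j) (f j) i = gK * u ^+ i by rewrite mulr_algl.
have gen_eltE om t G : gen_elt gamma (f j) om t G = u ^+ om + gK * (u ^+ t * G).
  by rewrite mulr_algl.
have unitG e G : zero_or_unit_expansion T (f j) (d j) e G ->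
    G <> 0 -> @invertible {poly %/ k j} G.
  by case=> [->|[]].
split; last split; last split; last split.
- by move=> ->; rewrite cards1.
- move=> ->; rewrite cardsT (card_gamma_chain chainK) QE.
  by apply: twiceE; lia.
- move=> tau lttau ->; rewrite gpowE (gamma_chain_card chainK) ?QE //.
  exact: ltnW.
- move=> om t G [kappa [_ /andP[om_gt0 /ltnW leom] _ hG]] ->.
  rewrite gen_eltE; split.
    move=> hp.
    have gw0 : gK * w = 0.
      have pR : p \in [pchar {poly R}] by rewrite pchar_poly inE p_prime hp dvdnn.
      (* The f_i^N are another monic factorization of x^(n N) - alpha. *)
      have kE : k j = f j ^+ N.
        apply: (@monic_factorization_unique _ _ _ _ gamma_neq0 gamma_sq pi_res r k
          (fun i => f i ^+ N)) => //.
        - by move=> i; apply: monic_exp.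
        - by move=> i; rewrite (map_pi_k gamma_neq0 gamma_sq pi_res (k_def i)) rmorphXn.
        - move=> i i' /k_coprime; exact: coprimep_map_poly.
        - rewrite prodrXl -f_prod -k_prod exprBn_pchar // -exprM beta_eq0 mulr0 addr0.
          by rewrite -rmorphXn alpha0_pow.
      have g0 : gamma *: g j = 0 by have := k_def j; rewrite kE -[LHS]addr0 => /addrI.
      by rewrite /gK mulr_algl scalerN -in_qpolyZ g0 in_qpoly0 oppr0.
    have E : gK * (w + u ^+ (N - om) * (u ^+ t * G)) = gK * (u ^+ (N - om + t) * G).
      by rewrite mulrDr gw0 add0r exprD; ring.
    have cardG : G <> 0 -> #|pideal (u ^+ om + gK * (u ^+ t * G))|
        = (p ^ (m * d j * (N - minn om (N - om + t) + (N - om))))%N.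
      by move=> G0; rewrite (card_pideal_gen chainK leom (unitG _ _ hG G0) E) QE.
    split=> [[G0|[G0 le]]|[G0 lt]].
    + rewrite (card_pideal_gen0 chainK leom) ?QE; last by rewrite E G0 !mulr0.
      by apply: twiceE; lia.
    + by rewrite cardG //; apply: twiceE; lia.
    + by rewrite cardG //; apply: sameE; lia.
  move=> hp2 is_decomp.
  have [gE [x [y copM]]] := M_def hp2 j.
  set M' := in_qpoly (k j) (M j) in is_decomp *.
  (* M is invertible modulo f, hence modulo the maximal ideal. *)
  have M'_unit : @invertible {poly %/ k j} M'.
    apply: (@invertible_mod_maximal _ gK u w N M' (in_qpoly _ x) (in_qpoly _ y) 0).
    - exact: gamma_chain_sqr chainK.
    - exact: gamma_chain_pow chainK.
    - by rewrite mulr0 addr0 [M' * _]mulrC -!in_qpolyM -in_qpolyD copM in_qpoly1.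
  have wE : w = - (u ^+ P * M') by rewrite /w gE in_qpolyM rmorphXn.
  split.
    have := gamma_chain_val chainK (M' - G).
    move=> [E0|[i [e [ltiN e_unit E0]]]].
      exists 0%N, 0; split; [exact: N_gt0|by left|].
      by rewrite !scaleE E0 !mulr0.
    by exists i, e; split; [exact: ltiN|by right|rewrite !scaleE].
  move=> delta B [ltdN B_unit]; rewrite !scaleE => BE.
  have B0unit : B <> 0 -> @invertible {poly %/ k j} B by case: B_unit.
  (* The number subtracted from the first N is the torsion exponent kappa. *)
  have cardG0 : G = 0 -> #|pideal (u ^+ om + gK * (u ^+ t * G))|
     = (p ^ (m * d j * (N - minn om P + (N - om))))%N.
    by move=> G0; rewrite (card_typeIII_G_large chainK wE) ?QE //; left.
  have cardgt : (P < N - om + t)%N -> #|pideal (u ^+ om + gK * (u ^+ t * G))|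
     = (p ^ (m * d j * (N - minn om P + (N - om))))%N.
    by move=> h; rewrite (card_typeIII_G_large chainK wE) ?QE //; right.
  have cardlt : G <> 0 -> (N - om + t < P)%N -> #|pideal (u ^+ om + gK * (u ^+ t * G))|
     = (p ^ (m * d j * (N - minn om (N - om + t) + (N - om))))%N.
    by move=> /(unitG _ _ hG) h h'; rewrite (card_typeIII_G_small chainK wE) ?QE.
  have cardeq : B <> 0 -> (N - om + t = P)%N ->
     #|pideal (u ^+ om + gK * (u ^+ t * G))|
     = (p ^ (m * d j * (N - minn om (P + delta) + (N - om))))%N.
    by move=> /B0unit h h'; rewrite (card_typeIII_G_equal chainK wE _ h' BE) ?QE.
  have cardeqM : B = 0 -> (N - om + t = P)%N ->
     #|pideal (u ^+ om + gK * (u ^+ t * G))|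
     = (p ^ (m * d j * (N - om + (N - om))))%N.
    move=> B0 h'; rewrite (card_typeIII_G_eq_M chainK wE _ h') ?QE //.
    by rewrite BE B0 !mulr0.
  split=> [[[G0 h]|[G0 h1 h2 h3]|[B0 h]|[[B0 h1 h2]|[B0 h1 h2]]]|].
  - by rewrite cardG0 //; apply: twiceE; clear -h leom ltPN; lia.
  - case: (ltngtP P (N - om + t)) => cmp.
    + by rewrite cardgt //; apply: twiceE; clear -h1 h2 leom ltPN; lia.
    + by rewrite cardlt //; apply: twiceE; clear -h1 h2 leom ltPN; lia.
    + by case: h3; clear -cmp h1 h2 leom ltPN; lia.
  - by rewrite cardeqM //; [apply: twiceE|]; clear -h leom ltPN; lia.
  - by rewrite cardeq //; [apply: twiceE|]; clear -h1 h2 leom ltPN; lia.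
  - by rewrite cardeq //; [apply: twiceE|]; clear -h1 h2 leom ltPN; lia.
  split=> [[G0 h1 h2]|].
    by rewrite cardlt //; [apply: sameE|]; clear -h1 h2 leom ltPN; lia.
  split=> [[[G0 h]|[G0 h1 h2]]|[B0 h1 h2]].
  - by rewrite cardG0 //; apply: sameE; clear -h leom ltPN; lia.
  - by rewrite cardgt //; [apply: sameE|]; clear -h1 h2 leom ltPN; lia.
  - by rewrite cardeq //; [apply: sameE|]; clear -h1 h2 leom ltPN; lia.
- move=> om t mu G [kappa [[_ least] [ltmu leka ltom] _ _]] ->.
  rewrite gen_eltE gpowE (card_pideal2_gen chainK) ?QE //; try lia.
    by apply: sameE; lia.
  move=> i; rewrite -gen_eltE -gpowE => /least; lia.
Qed.
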